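(* Let $P$ be an increasing tableau of normal shape with $C$ columns, and for $1\le i\le j$ let $P_{i,j}=P_i\triangleleft(P_{i+1}\triangleleft(\cdots\triangleleft P_j))$. Suppose an anti-rectification of $P$ (with any choices of placements of $\bullet$'s) produces an anti-normal increasing tableau $P^{\searrow}$ whose rightmost column is column $C$. Then the set of entries in column $1$ of $P^{\searrow}$ equals $P_{1,C}$.
   Context: Tableaux are drawn in English convention; $T_j$ is the set of (integer) entries of column $j$. For finite $S,T\subseteq\mathbb{Z}_{>0}$, $T\triangleleft S$ is obtained by going through $S$ from largest to smallest, each $s$ picking the largest not-yet-picked element of $T$ less than $s$ (if any), and taking the set of picked elements. A skew diagram $\lambda/\mu$ is the set difference of two nested Young diagrams; it is normal if $\mu=\emptyset$ and anti-normal if it is right- and bottom-justified (i.e. $\lambda$ is a rectangle). An increasing skew tableau is a filling of a skew diagram with positive integers strictly increasing along rows and columns. A dotted skew tableau is a filling of a skew diagram with positive integers and the symbol $\bullet$; for $m\ge0$, $\mathrm{sInc}_{m<\bullet}$ is the set of dotted skew tableaux whose rows and columns are strictly increasing for the order $1<\cdots<m<\bullet<m+1<\cdots$. For $m\ge1$, the reverse K-jeu-de-taquin move $\mathrm{sInc}_{m<\bullet}\to\mathrm{sInc}_{m-1<\bullet}$ simultaneously replaces every $\bullet$ that is edge-adjacent to an $m$ by $m$ and every $m$ that is edge-adjacent to a $\bullet$ by $\bullet$ (shape preserved). One anti-rectification step on an increasing skew tableau with entries at most $m$: add some new cells filled with $\bullet$ so that the result is a dotted skew tableau in $\mathrm{sInc}_{m<\bullet}$,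 apply the reverse K-jeu-de-taquin moves for $m,m-1,\dots,1$ to get an element of $\mathrm{sInc}_{0<\bullet}$, then delete all $\bullet$ cells. Anti-rectification repeats such steps (with arbitrary choices) until the shape is anti-normal. *)

(* Defs.v *)
From mathcomp Require Import all_boot.
Set Implicit Arguments. Unset Strict Implicit. Unset Printing Implicit Defensive.

(* Cells are (row r, column c), 1-indexed (English convention: row 1 on top,
   column 1 on the left).  Cells with a 0 coordinate are never in a diagram. *)

Definition tab := nat -> nat -> option nat.

Inductive dentry := DNum of nat | Dot.
Definition dtab := nat -> nat -> option dentry.

(* partitions: weakly decreasing sequences (zero parts harmless) *)
Definition is_part (la : seq nat) : bool := sorted geq la.

Definition in_young (la : seq nat) (r c : nat) : bool :=
  [&& 0 < r, 0 < c & c <= nth 0 la r.-1].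

Definition part_le (mu la : seq nat) : Prop := forall i, nth 0 mu i <= nth 0 la i.

Definition skew (D : nat -> nat -> bool) : Prop :=
  exists la mu, [/\ is_part la, is_part mu, part_le mu la &
    forall r c, D r c = in_young la r c && ~~ in_young mu r c].

Definition antinormal (D : nat -> nat -> bool) : Prop :=
  exists a b mu, [/\ is_part mu, part_le mu (nseq a b) &
    forall r c, D r c = in_young (nseq a b) r c && ~~ in_young mu r c].

Definition tshape (t : tab) : nat -> nat -> bool := fun r c => isSome (t r c).
Definition dshape (t : dtab) : nat -> nat -> bool := fun r c => isSome (t r c).

Definition incr (t : tab) : Prop :=
  [/\ skew (tshape t),
      (forall r c x, t r c = Some x -> 0 < x),
      (forall r c c' x y, c < c' -> t r c = Some x -> t r c' = Some y -> x < y) &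
      (forall r r' c x y, r < r' -> t r c = Some x -> t r' c = Some y -> x < y)].

Definition ltm (m : nat) (a b : dentry) : bool :=
  match a, b with
  | DNum x, DNum y => x < y
  | DNum x, Dot => x <= m
  | Dot, DNum y => m < y
  | Dot, Dot => false
  end.

Definition sInc (m : nat) (t : dtab) : Prop :=
  [/\ skew (dshape t),
      (forall r c x, t r c = Some (DNum x) -> 0 < x),
      (forall r c c' x y, c < c' -> t r c = Some x -> t r c' = Some y -> ltm m x y) &
      (forall r r' c x y, r < r' -> t r c = Some x -> t r' c = Some y -> ltm m x y)].

Definition isnum (k : nat) (e : option dentry) : bool :=
  if e is Some (DNum x) then x == k else false.
Definition isdot (e : option dentry) : bool :=
  if e is Some Dot then true else false.

(* some edge-adjacent cell satisfies p (cells with coordinate 0 are empty) *)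
Definition adj (p : option dentry -> bool) (t : dtab) (r c : nat) : bool :=
  [|| p (t r.-1 c), p (t r.+1 c), p (t r c.-1) | p (t r c.+1)].

(* reverse K-jeu-de-taquin move for k : sInc_{k<.} -> sInc_{k-1<.} *)
Definition kmove (k : nat) (t : dtab) : dtab := fun r c =>
  match t r c with
  | Some Dot => if adj (isnum k) t r c then Some (DNum k) else Some Dot
  | Some (DNum x) => if (x == k) && adj isdot t r c then Some Dot else Some (DNum x)
  | None => None
  end.

Fixpoint rslides (m : nat) (t : dtab) : dtab :=
  match m with 0 => t | k.+1 => rslides k (kmove k.+1 t) end.

Definition embed (t : tab) (D : nat -> nat -> bool) : dtab := fun r c =>
  match t r c with
  | Some x => Some (DNum x)
  | None => if D r c then Some Dot else None
  end.

Definition undot (t : dtab) : tab := fun r c =>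
  match t r c with Some (DNum x) => Some x | _ => None end.

Definition arstep (t t' : tab) : Prop :=
  incr t /\
  exists (m : nat) (D : nat -> nat -> bool),
    [/\ (forall r c x, t r c = Some x -> x <= m),
        (forall r c, D r c -> t r c = None),
        sInc m (embed t D) &
        forall r c, t' r c = undot (rslides m (embed t D)) r c].

Inductive antirect : tab -> tab -> Prop :=
| ar_done t : antinormal (tshape t) -> antirect t t
| ar_step t t' u : ~ antinormal (tshape t) -> arstep t t' -> antirect t' u ->
    antirect t u.

Definition ncols (t : tab) (C : nat) : Prop :=
  (exists r, isSome (t r C)) /\ (forall r c, isSome (t r c) -> c <= C).

Fixpoint tri_aux (T S : seq nat) : seq nat :=
  match S with
  | [::] => [::]
  | s :: S' =>
      let cs := [seq t <- T | t < s] in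
      if cs is [::] then tri_aux T S'
      else let p := foldr maxn 0 cs in p :: tri_aux (rem p T) S'
  end.
Definition tri (T S : seq nat) : seq nat := tri_aux (undup T) (sort geq (undup S)).

Definition col (la : seq nat) (P : tab) (j : nat) : seq nat :=
  pmap (fun r => P r j) (iota 1 (size la)).

Definition Pij (la : seq nat) (P : tab) (i j : nat) : seq nat :=
  foldr (fun k acc => tri (col la P k) acc) (col la P j) (iota i (j - i)).

(* Main.v *)
Require Import Defs.
From mathcomp Require Import all_boot.
From mathcomp Require Import zify.

(** Write T_j for the set of entries of column j. By the min-cut theorem for
    threshold bipartite graphs, the number of elements greater than x of
    T_1 <| (T_2 <| ... <| T_C) is the minimum, over all thresholds
    x = th_0 <= th_1 <= ... <= th_C = M with M large, of the sum of the numbers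
    of entries of T_j lying strictly between th_(j-1) and th_j.  Note that a
    value equal to a threshold costs nothing.

    This minimum, computed from the numbers alone and ignoring the dots, does
    not change under a single reverse move for k.  Such a move only alters
    which columns contain k.  If k enters column j, then the dot it replaces
    has k on its left, so above that row each entry of column j-1 has a larger
    entry of column j on its right, and raising th_(j-1) to k does not increase
    the cost; if k leaves column j, then it has a dot on its right and lowering
    th_j to k works for the symmetric reason.

    In an anti-normal tableau every cell outside the last column has a right
    neighbour, so the minimum is the number of entries greater than x in the
    first column. *)

Set Implicit Arguments.
Unset Strict Implicit.
Unset Printing Implicit Defensive.

(** * Counting in lists, and sets recovered from their counts *)

Lemma count_add_le (T : Type) (p1 p2 q1 q2 : pred T) (s : seq T) :
  (forall v, p1 v + p2 v <= q1 v + q2 v) ->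
  count p1 s + count p2 s <= count q1 s + count q2 s.
Proof.
move=> H; elim: s => //= v s IH; have := H v; lia.
Qed.

Lemma count_le_add (T : Type) (p q1 q2 : pred T) (s : seq T) :
  (forall v, p v -> q1 v || q2 v) -> count p s <= count q1 s + count q2 s.
Proof.
move=> H; rewrite -[count p s]addn0 -(count_pred0 s); apply: count_add_le => v.
by have := H v; case: (p v) => //= /(_ isT); case: (q1 v); case: (q2 v).
Qed.

Lemma count_off (T : eqType) (k : T) (p : pred T) (s s' : seq T) :
  uniq s -> uniq s' -> (forall v, v != k -> (v \in s) = (v \in s')) ->
  ~~ p k -> count p s = count p s'.
Proof.
move=> us us' H pk; rewrite -!size_filter; apply/perm_size/uniq_perm.
- exact: filter_uniq.
- exact: filter_uniq.
move=> v; rewrite !mem_filter; case pv: (p v) => //=; apply: H.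
by apply: contraNneq pk => <-.
Qed.

Lemma count_pmap (S T : Type) (f : S -> option T) (p : pred T) (s : seq S) :
  count p (pmap f s) = count (fun r => oapp p false (f r)) s.
Proof. by elim: s => //= r s <-; case: (f r). Qed.

Lemma pmap_uniq_inj (S T : eqType) (f : S -> option T) (s : seq S) :
  (forall r r' v, f r = Some v -> f r' = Some v -> r = r') ->
  uniq s -> uniq (pmap f s).
Proof.
move=> inj; elim: s => //= r s IH /andP[rs us].
case E: (f r) => [v|] /=; last exact: IH.
rewrite IH // andbT mem_pmap; apply/negP => /mapP[r' r's E'].
by rewrite (inj _ _ _ E (esym E')) r's in rs.
Qed.

(** Membership of [v.+1] is the difference of the counts above [v] and above [v.+1]. The value 0
    exceeds no threshold, so it has to be excluded separately. *)
Lemma mem_of_count_gt (s s' : seq nat) :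
  uniq s -> uniq s' -> 0 \notin s -> 0 \notin s' ->
  (forall x, count (fun v => x < v) s = count (fun v => x < v) s') -> s =i s'.
Proof.
move=> us us' s0 s0' H [|v]; first by rewrite (negbTE s0) (negbTE s0').
suff E t : uniq t ->
    (v.+1 \in t) + count (fun u => v.+1 < u) t = count (fun u => v < u) t.
  have := E _ us; have := E _ us'; rewrite !H.
  by case: (_ \in s); case: (_ \in s') => //; lia.
move=> ut; rewrite -(count_uniq_mem _ ut).
elim: t {ut} => //= u t IH; case: eqP => [->|]; lia.
Qed.

(** * Cuts through a sequence of columns *)

(** The starting index [a] is free so that columns can be peeled off from the left; column [j.+1] is
    governed by [th j] and [th j.+1]. *)
Definition thresholds (a C x M : nat) (th : nat -> nat) : Prop :=
  [/\ th a = x, th C = M & forall j, a <= j < C -> th j <= th j.+1].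

Definition between (a b : nat) : pred nat := fun v => a < v < b.

Definition cutcost (a C : nat) (T : nat -> seq nat) (th : nat -> nat) : nat :=
  \sum_(a <= j < C) count (between (th j) (th j.+1)) (T j.+1).

Lemma thresholds_mono a C x M th : thresholds a C x M th ->
  forall i j, a <= i -> i <= j -> j <= C -> th i <= th j.
Proof.
move=> [_ _ mono] i j ai; elim: j => [|j IH]; first by rewrite leqn0 => /eqP->.
rewrite leq_eqVlt => /orP[/eqP->//|ij] jC.
by apply: leq_trans (IH _ _) (mono _ _); lia.
Qed.

(** Says that the minimum cut of [T'] is at most that of [T], for all prescribed ends, without
    forming a minimum. *)
Definition cuts_le (C : nat) (T T' : nat -> seq nat) : Prop :=
  forall x M th, thresholds 0 C x M th ->
  exists2 th', thresholds 0 C x M th' & cutcost 0 C T' th' <= cutcost 0 C T th.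

Lemma cuts_le_trans C T2 T1 T3 :
  cuts_le C T1 T2 -> cuts_le C T2 T3 -> cuts_le C T1 T3.
Proof.
move=> H12 H23 x M th /H12[th2 /H23[th3 A3 le3] le2].
by exists th3 => //; apply: leq_trans le2.
Qed.

(** An increase of at most [e] at [i] is paid for by a saving of at least [e] at [j]. *)
Lemma sum_transfer (F F' : nat -> nat) (C i j e : nat) :
  i < C -> j < C ->
  (forall l, l < C -> F' l + (l == j) * e <= F l + (l == i) * e) ->
  \sum_(0 <= l < C) F' l <= \sum_(0 <= l < C) F l.
Proof.
move=> iC jC H.
have E n : n < C -> \sum_(0 <= l < C) (l == n) * e = e.
  move=> nC; rewrite big_mkord (bigD1 (Ordinal nC)) //= eqxx mul1n.
  by rewrite big1 ?addn0 // => l /eqP ne; case: eqP => // ln; case: ne; apply: val_inj.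
have : \sum_(0 <= l < C) (F' l + (l == j) * e) <=
       \sum_(0 <= l < C) (F l + (l == i) * e).
  by rewrite !big_mkord; apply: leq_sum => l _; apply: H.
by rewrite !big_split /= !E // leq_add2r.
Qed.

(* When the value k enters column p strictly between the two thresholds of that
   column, moving one of these thresholds to k makes k free again; the
   hypothesis bounds the price of this move. *)
Lemma cuts_le_exchange (C k : nat) (T T' : nat -> seq nat) :
  (forall j, uniq (T j)) -> (forall j, uniq (T' j)) ->
  (forall j v, v != k -> (v \in T j) = (v \in T' j)) ->
  (forall p, p < C -> k \in T' p.+1 -> k \notin T p.+1 ->
     (0 < p /\ forall u, u < k ->
        count (fun v => u <= v < k) (T' p) <= count (between u k) (T' p.+1)) \/
     (p.+1 < C /\ forall w, k < w ->
        count (fun v => k < v <= w) (T p.+2) <= count (between k w) (T p.+1))) ->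
  cuts_le C T T'.
Proof.
move=> uT uT' off fixk x M th Hth.
have mono := thresholds_mono Hth.
have [th0 thC step] := Hth.
have cE p j : ~~ p k -> count p (T' j) = count p (T j).
  by move=> pk; symmetry; apply: (@count_off _ k) => // v; apply: off.
(* If no column whose thresholds straddle [k] gains it, the old thresholds still serve. *)
have [good|] := boolP [forall p : 'I_C,
    (th p < k < th p.+1) && (k \in T' p.+1) ==> (k \in T p.+1)].
  exists th => //; rewrite /cutcost !big_mkord; apply: leq_sum => p _.
  have {good} := forallP good p; case Bk: (th p < k < th p.+1); last first.
    by move=> _; rewrite cE // /between Bk.
  rewrite /= => gp; rewrite -!size_filter; apply: uniq_leq_size.
    exact: filter_uniq.
  move=> v; rewrite !mem_filter => /andP[-> /=].
  by have [->|/off->//] := eqVneq v k; move/implyP: gp.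
rewrite negb_forall => /existsP[[p pC] /=].
rewrite negb_imply => /andP[/andP[/andP[uk kw] kT'] kT].
(* By monotonicity [p] is the only index whose open interval contains [k], so every other column is
   charged the same in [T] and [T']. *)
have bnd l : l < C -> l != p -> ~~ between (th l) (th l.+1) k.
  move=> lC lp; have [lt|le] := ltnP l p.
    by have := mono l.+1 p isT lt (ltnW pC); rewrite /between; lia.
  have pl : p < l by rewrite ltn_neqAle eq_sym lp.
  by have := mono p.+1 l isT pl (ltnW lC); rewrite /between; lia.
have [[p0 fx]|[pC1 fx]] := fixk p pC kT' kT.
  (* Raise [th p] to [k]: column [p] may newly pay for its entries in $[th_p,k)$, while column
     [p.+1] saves those in $(th_p,k)$. *)
  exists (fun i => if i == p then k else th i).
    split=> [||j /andP[_ jC]]; first by rewrite ifN //; lia.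
      by rewrite ifN //; lia.
    have sj := step j jC; have [jp|jp] := eqVneq j p; have [jp1|jp1] := eqVneq j.+1 p => //.
    - by subst j; lia.
    - by apply: leq_trans sj _; rewrite jp1 ltnW.
  apply: (@sum_transfer _ _ C p.-1 p (count (fun v => th p <= v < k) (T' p))) => //.
    lia.
  move=> l lC.
  have [->|lp] := eqVneq l p; rewrite /= ?mul1n ?mul0n ?addn0.
    rewrite (_ : p == p.-1 = false); last lia.
    rewrite (_ : p.+1 == p = false); last lia.
    rewrite mul0n addn0.
    apply: (leq_trans (leq_add (leqnn _) (fx _ uk))).
    rewrite cE ?(cE (between (th p) k)) /between ?ltnn ?andbF //.
    set c := count _ _; rewrite -[leqRHS]addn0 -(count_pred0 (T p.+1)).
    by apply: count_add_le => v /=; lia.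
  have [E|lp1] := eqVneq l p.-1; rewrite ?mul1n ?mul0n ?addn0.
    have {E} pE : l.+1 = p by lia.
    rewrite pE eqxx.
    have -> : count (between (th l) (th p)) (T p) = count (between (th l) (th p)) (T' p).
      by rewrite cE // -pE bnd.
    by apply: count_le_add => v; rewrite /between; lia.
  rewrite ifN; last lia.
  by rewrite cE // bnd.
(* Symmetrically, lower [th p.+1] to [k]; column [p.+2] pays and column [p.+1] saves. *)
exists (fun i => if i == p.+1 then k else th i).
  split=> [||j /andP[_ jC]]; first by [].
    by rewrite ifN //; lia.
  have sj := step j jC; case: ifP => [/eqP jp|_]; case: ifP => [/eqP jp'|_] //.
  - by apply: leq_trans sj; rewrite jp ltnW.
  - by have -> : j = p by [lia]; exact: ltnW.
apply: (@sum_transfer _ _ C p.+1 p (count (fun v => k < v <= th p.+1) (T p.+2))) => //.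
move=> l lC.
have [->|lp] := eqVneq l p; rewrite /= ?mul1n ?mul0n ?addn0.
  rewrite (_ : p == p.+1 = false); last lia.
  rewrite eqxx mul0n addn0.
  apply: (leq_trans (leq_add (leqnn _) (fx _ kw))).
  rewrite cE /between ?ltnn ?andbF //.
  rewrite -[leqRHS]addn0 -(count_pred0 (T p.+1)).
  by apply: count_add_le => v /=; lia.
have [->|lp1] := eqVneq l p.+1; rewrite ?mul1n ?mul0n ?addn0.
  rewrite ifN; last lia.
  rewrite cE; last by rewrite /between ltnn.
  by apply: count_le_add => v; rewrite /between; lia.
rewrite eqSS (negbTE lp).
by rewrite cE // bnd.
Qed.

(** * The operation [tri] *)

Lemma mem_foldr_maxn (s : seq nat) : s != [::] -> foldr maxn 0 s \in s.
Proof.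
elim: s => //= a s IH _; rewrite inE; have [->|/IH m] := eqVneq s [::].
  by rewrite /= maxn0 eqxx.
by case: (leqP a (foldr maxn 0 s)) => _; rewrite ?m ?eqxx ?orbT.
Qed.

Lemma leq_foldr_maxn (s : seq nat) v : v \in s -> v <= foldr maxn 0 s.
Proof.
elim: s => //= a s IH; rewrite inE => /orP[/eqP->|/IH]; first exact: leq_maxl.
by move/leq_trans; apply; exact: leq_maxr.
Qed.

Variant tri_spec (T : seq nat) (s : nat) (S : seq nat) : seq nat -> Prop :=
| TriSkip of (forall t, t \in T -> s <= t) : tri_spec T s S (tri_aux T S)
| TriPick p of p \in T & p < s & (forall t, t \in T -> t < s -> t <= p) :
    tri_spec T s S (p :: tri_aux (rem p T) S).

Lemma triP T s S : tri_spec T s S (tri_aux T (s :: S)).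
Proof.
have memcs t : (t \in [seq t <- T | t < s]) = (t < s) && (t \in T).
  by rewrite mem_filter.
rewrite /=; move: memcs; case: [seq t <- T | t < s] => [|c cs] memcs.
  constructor=> t tT; rewrite leqNgt; apply/negP => ts.
  by have := memcs t; rewrite ts tT in_nil.
have := @mem_foldr_maxn (c :: cs) isT; rewrite memcs => /andP[ps pT].
constructor=> // t tT ts; apply: leq_foldr_maxn.
by rewrite memcs ts tT.
Qed.

Lemma tri_aux_uniq_sub T S :
  uniq T -> uniq (tri_aux T S) /\ {subset tri_aux T S <= T}.
Proof.
elim: S T => [|s S IH] T uT; first by [].
case: triP => [_|p pT ps _]; first exact: IH.
have [uS sub] := IH _ (rem_uniq p uT).
split=> [|v /=]; last first.
  by rewrite inE => /orP[/eqP->//|/sub/mem_rem].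
rewrite /= uS andbT; apply/negP => /sub.
by rewrite mem_rem_uniq // inE eqxx.
Qed.

Lemma count_rem (p : pred nat) (t : nat) (T : seq nat) :
  t \in T -> count p T = p t + count p (rem t T).
Proof. by move=> /perm_to_rem/permP->. Qed.

(** A picked element above [x] is either below [th], hence charged in [T], or at least [th], and
    then the element of [S] that picked it exceeds [th]. *)
Lemma tri_aux_le T S x th : x <= th ->
  count (fun v => x < v) (tri_aux T S) <=
  count (between x th) T + count (fun v => th < v) S.
Proof.
move=> xth; elim: S T => [|s S IH] T; first by [].
case: triP => [_|p pT ps _] /=.
  by apply: leq_trans (IH T) _; lia.
have := IH (rem p T); rewrite (count_rem _ pT).
by have -> : between x th p = (x < p < th) by []; lia.
Qed.

(** The greedy choice is optimal: some threshold makes the preceding bound tight. It is built along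
    the run of the algorithm. *)
Lemma tri_aux_ge T S x M : sorted geq S -> all (leq^~ M) S -> x <= M ->
  exists2 th, x <= th <= M &
  count (between x th) T + count (fun v => th < v) S <=
  count (fun v => x < v) (tri_aux T S).
Proof.
move=> + + xM; elim: S T => [|s S IH] T srt.
  move=> _; exists x; first by rewrite leqnn.
  by rewrite /= addn0 (@eq_count _ _ pred0) ?count_pred0 // => v; rewrite /between /=; lia.
rewrite [all _ _]/= => /andP[sM SM].
have maxS : all (geq s) S.
  by apply: order_path_min srt => a b c ab ca; apply: leq_trans ab.
have S0 th : s <= th -> count (fun v => th < v) S = 0.
  move=> sth; apply/eqP; rewrite -leqn0 leqNgt -has_count; apply/hasPn => v vS.
  by rewrite -leqNgt; apply: leq_trans sth; apply: (allP maxS).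
case: (triP T s S) => [sT|p pT ps pmax] /=.
  (* All of [T] is at least [s] and all of [S] at most [s], so this cut costs nothing. *)
  exists (maxn x s); first by rewrite leq_maxl geq_max xM.
  rewrite S0 ?leq_maxr // ltnNge leq_maxr /= addn0.
  rewrite (@eq_in_count _ _ pred0) ?count_pred0 // => v /sT.
  by rewrite /between /=; lia.
have [th /andP[xth thM] Hth] := IH (rem p T) (path_sorted srt) SM.
(* At the inductive [th], the pair of [s] and [p] adds more to the cost than to the count exactly in
   the bad case. *)
have [bad|good] := boolP ((th < s) && (between x th p || (p <= x))); last first.
  exists th; first by rewrite xth.
  rewrite (count_rem _ pT); move: good Hth.
  by have -> : between x th p = (x < p < th) by []; lia.
(* Raising the threshold to [s] frees [S]. By maximality of [p], no element of [T] above [x] lies in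
   $[th,s)$, so nothing in [T] is newly charged. *)
exists s; first by apply/andP; split=> //; lia.
rewrite (count_rem _ pT) ltnn S0 // !addn0.
have -> : count (between x s) (rem p T) = count (between x th) (rem p T).
  apply: eq_in_count => v /mem_rem vT.
  by have := pmax v vT; move: bad; rewrite /between; lia.
move: bad Hth; have -> : between x th p = (x < p < th) by [].
by have -> : between x s p = (x < p < s) by []; lia.
Qed.

Lemma tri_uniq T S : uniq (tri T S).
Proof. by have [] := tri_aux_uniq_sub (sort geq (undup S)) (undup_uniq T). Qed.

Lemma mem_tri T S : {subset tri T S <= T}.
Proof.
by have [_ sub] := tri_aux_uniq_sub (sort geq (undup S)) (undup_uniq T) => v /sub; rewrite mem_undup.
Qed.

(** * Min-cut formula for the iterated operation *)

Section IteratedTri.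

Variables (T : nat -> seq nat) (C M : nat).
Hypothesis uniqT : forall j, uniq (T j).
Hypothesis boundT : forall j, all (ltn^~ M) (T j).

(** This is $T_{C-n}\triangleleft(\cdots\triangleleft T_C)$, involving the last [n.+1] columns. *)
Let itri n := foldr (fun k acc => tri (T k) acc) (T C) (iota (C - n) n).

Lemma itriS n : n < C -> itri n.+1 = tri (T (C - n.+1)) (itri n).
Proof. by move=> nC; rewrite /itri /= -subSn. Qed.

Lemma itri_uniq n : n < C -> uniq (itri n).
Proof. by case: n => [_|n nC]; [exact: uniqT | rewrite itriS ?tri_uniq //; exact: ltnW]. Qed.

Lemma itri_bound n : n < C -> all (ltn^~ M) (itri n).
Proof.
case: n => [_|n nC]; first exact: boundT.
rewrite itriS; last exact: ltnW.
by apply/allP => v /mem_tri; exact: (allP (boundT _)).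
Qed.

Lemma count_sort_undup (p : pred nat) s : uniq s ->
  count p (sort geq (undup s)) = count p s.
Proof.
by move=> us; rewrite undup_id //; apply/permP; rewrite perm_sort.
Qed.

(** Weak duality, peeling off the leftmost column. Entries are strictly below [M], so the last open
    interval misses none of them. *)
Lemma itri_le n x th : n < C -> thresholds (C - n.+1) C x M th ->
  count (fun v => x < v) (itri n) <= cutcost (C - n.+1) C T th.
Proof.
elim: n x => [|n IH] x nC [tha thC mono].
  rewrite /cutcost subn1 -[in X in _ <= X](prednK nC) big_nat1 prednK // thC.
  rewrite -subn1 tha /itri /=; apply/eq_leq/eq_in_count => v vT.
  have vM : v < M by exact: (allP (boundT C)).
  by rewrite /between vM andbT.
have nC' := ltnW nC.
have E : (C - n.+2).+1 = C - n.+1 by lia.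
have Hth : thresholds (C - n.+1) C (th (C - n.+1)) M th.
  by split=> // j /andP[j1 j2]; apply: mono; lia.
rewrite /cutcost big_ltn; last lia.
rewrite E tha itriS //; apply: leq_trans (@tri_aux_le _ _ _ (th (C - n.+1)) _) _.
  by rewrite -tha -E; apply: mono; lia.
rewrite undup_id // count_sort_undup ?itri_uniq // leq_add2l.
exact: IH.
Qed.

(** Strong duality: [tri_aux_ge] supplies the threshold [t] behind the leftmost column, and
    induction continues the cut from [t]. *)
Lemma itri_ge n x : n < C -> x <= M ->
  exists2 th, thresholds (C - n.+1) C x M th &
  cutcost (C - n.+1) C T th <= count (fun v => x < v) (itri n).
Proof.
elim: n x => [|n IH] x nC xM.
  exists (fun i => if i == C then M else x).
    split; rewrite ?eqxx ?ifN //; try lia.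
    by move=> j /andP[j1 j2]; case: eqP => ?; case: eqP => ? //; lia.
  rewrite /cutcost subn1 -[in X in X <= _](prednK nC) big_nat1 prednK // eqxx.
  rewrite ifN; last lia.
  by apply: sub_count => v /andP[].
have nC' := ltnW nC.
have E : (C - n.+2).+1 = C - n.+1 by lia.
have [|||t /andP[xt tM] Ht] :=
  @tri_aux_ge (undup (T (C - n.+1))) (sort geq (undup (itri n))) x M.
- by apply: sort_sorted => a b; exact: leq_total.
- by rewrite all_sort; apply/allP => v; rewrite mem_undup => /(allP (itri_bound nC'))/ltnW.
- by [].
have [th [tha thC mono] Hth] := IH t nC' tM.
exists (fun i => if i == C - n.+2 then x else th i).
  split; rewrite ?eqxx ?ifN //; try lia.
  move=> j /andP[j1 j2]; rewrite [in leqRHS]ifN; last lia.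
  have [->|jn] := eqVneq j; first by rewrite E tha.
  by apply: mono; lia.
rewrite itriS // /tri; apply: leq_trans Ht.
rewrite undup_id // count_sort_undup ?itri_uniq //.
rewrite /cutcost big_ltn; last lia.
rewrite eqxx ifN; last lia.
rewrite E tha leq_add2l; apply: leq_trans Hth.
rewrite /cutcost big_nat [X in _ <= X]big_nat; apply/eq_leq/eq_bigr => j /andP[j1 j2].
by rewrite !ifN //; lia.
Qed.

End IteratedTri.

(** * Reverse K-jeu-de-taquin moves *)

Lemma nth_part (la : seq nat) i j :
  is_part la -> i <= j -> nth 0 la j <= nth 0 la i.
Proof.
move=> pla ij; have [lt|/(nth_default 0)->//] := ltnP j (size la).
have tr : transitive geq by move=> a b c ab ca; apply: leq_trans ab.
have rf : reflexive geq by exact: leqnn.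
by apply: (sorted_leq_nth tr rf 0 pla) => //; exact: leq_ltn_trans lt.
Qed.

Lemma skew_convex D r1 c1 r2 c2 r c : skew D -> D r1 c1 -> D r2 c2 ->
  r1 <= r <= r2 -> c1 <= c <= c2 -> D r c.
Proof.
move=> [la [mu [pla pmu _ DE]]]; rewrite !DE /in_young.
have := @nth_part la r.-1 r2.-1 pla; have := @nth_part mu r1.-1 r.-1 pmu.
lia.
Qed.

Lemma skew_rows D : skew D -> exists B, forall r c, D r c -> 0 < r <= B.
Proof.
move=> [la [mu [_ _ _ DE]]]; exists (size la) => r c; rewrite DE /in_young.
move=> /andP[/and3P[r0 c0 cla] _]; rewrite r0 /= leqNgt; apply/negP => lt.
by move: cla; rewrite nth_default; lia.
Qed.

Lemma dshape_kmove k t r c : dshape (kmove k t) r c = dshape t r c.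
Proof.
by rewrite /dshape /kmove; case: (t r c) => [[x|]|] //; case: ifP.
Qed.

(** Only [k.+1] followed by a dot would violate the new order, and swapping both repairs it;
    elsewhere the adjacency flags may be arbitrary. *)
Lemma ltm_kmove_line (k : nat) (a b : dentry) (adja adjb adja' adjb' : bool) :
  ltm k.+1 a b ->
  (a = DNum k.+1 -> b = Dot -> adja /\ adjb') ->
  ltm k (match a with
         | Dot => if adja' then DNum k.+1 else Dot
         | DNum x => if (x == k.+1) && adja then Dot else DNum x end)
        (match b with
         | Dot => if adjb' then DNum k.+1 else Dot
         | DNum x => if (x == k.+1) && adjb then Dot else DNum x end).
Proof.
case: a b => [x|] [y|] //= lt H.
- case: ifP => /= [/andP[/eqP xk _]|_]; case: ifP => /= [/andP[/eqP yk _]|_]; lia.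
- have [xk|xk] := eqVneq x k.+1.
    by have [||-> ->] := H => //; rewrite ?xk //= leqnn.
  by case: ifP => _ /=; lia.
- rewrite (_ : y == k.+1 = false) /=; last lia.
  by case: ifP => _ /=; lia.
Qed.

Section KMove.

Variables (k : nat) (t : dtab).
Hypothesis tinc : sInc k.+1 t.

Let u := kmove k.+1 t.

Lemma sInc_cell r1 c1 r2 c2 r c x y : t r1 c1 = Some x -> t r2 c2 = Some y ->
  r1 <= r <= r2 -> c1 <= c <= c2 -> exists z, t r c = Some z.
Proof.
case: tinc => sk _ _ _ t1 t2 hr hc.
have : dshape t r c by apply: (skew_convex sk _ _ hr hc); rewrite /dshape ?t1 ?t2.
by rewrite /dshape; case: (t r c) => // z _; exists z.
Qed.

Lemma not_between z : ltm k.+1 (DNum k.+1) z -> ltm k.+1 z Dot -> False.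
Proof. case: z => //= y; lia. Qed.

(** No value fits between [k.+1] and the dot, and convexity of the shape leaves no empty cell
    between them. *)
Lemma dot_next_row r c c' : c < c' -> t r c = Some (DNum k.+1) ->
  t r c' = Some Dot -> c' = c.+1.
Proof.
move=> lt tk td; apply/eqP; rewrite eqn_leq lt andbT leqNgt; apply/negP => lt'.
have [||z tz] := @sInc_cell r c r c' r c.+1 _ _ tk td; rewrite ?leqnn //; first lia.
by case: tinc => _ _ rinc _; apply: (@not_between z); [apply: rinc tk tz | apply: rinc tz td].
Qed.

Lemma dot_next_col r r' c : r < r' -> t r c = Some (DNum k.+1) ->
  t r' c = Some Dot -> r' = r.+1.
Proof.
move=> lt tk td; apply/eqP; rewrite eqn_leq lt andbT leqNgt; apply/negP => lt'.
have [||z tz] := @sInc_cell r c r' c r.+1 c _ _ tk td; rewrite ?leqnn //; first lia.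
by case: tinc => _ _ _ cinc; apply: (@not_between z); [apply: cinc tk tz | apply: cinc tz td].
Qed.

Lemma kmoveE r c : u r c = omap (fun e => match e with
  | Dot => if adj (isnum k.+1) t r c then DNum k.+1 else Dot
  | DNum x => if (x == k.+1) && adj isdot t r c then Dot else DNum x end) (t r c).
Proof. by rewrite /u /kmove; case: (t r c) => [[x|]|] //=; case: ifP. Qed.

Lemma kmove_sInc : sInc k u.
Proof.
have [[la [mu [pla pmu le DE]]] pos rinc cinc] := tinc; split.
- by exists la, mu; split=> // r c; rewrite dshape_kmove.
- move=> r c x; rewrite kmoveE; case E: (t r c) => [[y|]|] //=.
    by case: ifP => // _ [<-]; exact: pos E.
  by case: ifP => // _ [<-].
- move=> r c c' x y lt; rewrite !kmoveE.
  case E: (t r c) => [a|] //= [<-]; case E': (t r c') => [b|] //= [<-].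
  apply: ltm_kmove_line; first exact: rinc E E'.
  move=> ak bd; rewrite ak in E; rewrite bd in E'.
  have c'E := dot_next_row lt E E'; subst c'.
  by rewrite /adj /= E E' /= eqxx !orbT.
- move=> r r' c x y lt; rewrite !kmoveE.
  case E: (t r c) => [a|] //= [<-]; case E': (t r' c) => [b|] //= [<-].
  apply: ltm_kmove_line; first exact: cinc E E'.
  move=> ak bd; rewrite ak in E; rewrite bd in E'.
  have r'E := dot_next_col lt E E'; subst r'.
  by rewrite /adj /= E E' /= eqxx !orbT.
Qed.

Lemma cell0 r c : t r c <> None -> (0 < r) && (0 < c).
Proof.
have [[la [mu [_ _ _ DE]]] _ _ _] := tinc.
move=> ne; have : dshape t r c by rewrite /dshape; case: (t r c) ne.
by rewrite DE /in_young; lia.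
Qed.

Lemma adj_dot r c : t r c = Some (DNum k.+1) -> adj isdot t r c ->
  t r.+1 c = Some Dot \/ t r c.+1 = Some Dot.
Proof.
(* Positivity makes [r.-1] and [c.-1] true predecessors; a dot there would violate the order. *)
move=> tk; have /andP[r0 c0] : (0 < r) && (0 < c) by apply: cell0; rewrite tk.
have [_ _ rinc cinc] := tinc; rewrite /adj => /or4P[].
- case E: (t r.-1 c) => [[|]|] // _; have /= := cinc _ _ _ _ _ _ E tk; lia.
- by case E: (t r.+1 c) => [[|]|] // _; left.
- case E: (t r c.-1) => [[|]|] // _; have /= := rinc _ _ _ _ _ _ E tk; lia.
- by case E: (t r c.+1) => [[|]|] // _; right.
Qed.

Lemma adj_num r c : t r c = Some Dot -> adj (isnum k.+1) t r c ->
  t r.-1 c = Some (DNum k.+1) \/ t r c.-1 = Some (DNum k.+1).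
Proof.
move=> td; have [_ _ rinc cinc] := tinc; rewrite /adj => /or4P[].
- by case E: (t r.-1 c) => [[x|]|] //= /eqP xk; left; rewrite -xk.
- case E: (t r.+1 c) => [[x|]|] //= /eqP xk; have /= := cinc _ _ _ _ _ _ td E; lia.
- by case E: (t r c.-1) => [[x|]|] //= /eqP xk; right; rewrite -xk.
- case E: (t r c.+1) => [[x|]|] //= /eqP xk; have /= := rinc _ _ _ _ _ _ td E; lia.
Qed.

Lemma dot_gets_num r c r' c' : t r c = Some (DNum k.+1) -> t r' c' = Some Dot ->
  (r' = r.+1 /\ c' = c) \/ (r' = r /\ c' = c.+1) -> u r' c' = Some (DNum k.+1).
Proof.
move=> tk td H; rewrite kmoveE td /= ifT //.
by case: H => -[-> ->]; rewrite /adj /= tk /= eqxx ?orbT.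
Qed.

(** A number turned into a dot reappears below or to the right, so a column bound passes backwards
    through the move. *)
Lemma kmove_ncols C :
  (forall r c x, u r c = Some (DNum x) -> c <= C) ->
  (forall r c x, t r c = Some (DNum x) -> c <= C).
Proof.
move=> H r c x tx.
have [ad|ad] := boolP ((x == k.+1) && adj isdot t r c); last first.
  by apply: (H r c x); rewrite kmoveE tx /= (negbTE ad).
case/andP: ad => /eqP xk ad; rewrite xk in tx.
have [td|td] := adj_dot tx ad.
  by apply: (H r.+1 c k.+1); apply: dot_gets_num tx td _; left.
by apply: ltnW; apply: (H r c.+1 k.+1); apply: dot_gets_num tx td _; right.
Qed.

End KMove.

(** * Columns as lists of entries *)

(** One row bound [B] serves all tableaux under comparison, so that their columns are read over the
    same rows. *)
Definition colB (B : nat) (t : tab) (j : nat) : seq nat := pmap (t^~ j) (iota 1 B).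

Definition rows_in (B : nat) (D : nat -> nat -> bool) : Prop :=
  forall r c, D r c -> 0 < r <= B.

Lemma mem_colB B t j v : rows_in B (tshape t) ->
  reflect (exists r, t r j = Some v) (v \in colB B t j).
Proof.
move=> bt; rewrite /colB mem_pmap; apply: (iffP mapP) => [[r _ ->]|[r tr]].
  by exists r.
exists r => //; rewrite mem_iota.
have /bt : tshape t r j by rewrite /tshape tr.
lia.
Qed.

Lemma colB_uniq B (t : tab) j :
  (forall r r' c x y, r < r' -> t r c = Some x -> t r' c = Some y -> x < y) ->
  uniq (colB B t j).
Proof.
move=> inc; apply: pmap_uniq_inj (iota_uniq _ _) => r r' v tr tr'.
case: (ltngtP r r') => // lt.
  by have := inc _ _ _ _ _ lt tr tr'; rewrite ltnn.
by have := inc _ _ _ _ _ lt tr' tr; rewrite ltnn.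
Qed.

Lemma undot_Some t r c x : undot t r c = Some x <-> t r c = Some (DNum x).
Proof.
by rewrite /undot; case: (t r c) => [[y|]|]; split=> // -[->].
Qed.

Lemma rows_in_undot B t : rows_in B (dshape t) -> rows_in B (tshape (undot t)).
Proof.
by move=> H r c; rewrite /tshape /undot => h; apply: (H r c); rewrite /dshape; case: (t r c) h.
Qed.

Lemma undot_col_uniq B m t j : sInc m t -> uniq (colB B (undot t) j).
Proof.
move=> [_ _ _ inc]; apply: colB_uniq => r r' c x y lt /undot_Some tx /undot_Some ty.
exact: (inc _ _ _ _ _ lt tx ty).
Qed.

Lemma count_colB_le B (t t' : tab) j j' (p q : pred nat) :
  (forall r v, t r j = Some v -> p v -> exists2 w, t' r j' = Some w & q w) ->
  count p (colB B t j) <= count q (colB B t' j').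
Proof.
move=> H; rewrite /colB !count_pmap; apply: sub_count => r /=.
by case E: (t r j) => [v|] //= pv; have [w -> ] := H _ _ E pv.
Qed.

Lemma mem_undot_colB B t j v : rows_in B (dshape t) ->
  reflect (exists r, t r j = Some (DNum v)) (v \in colB B (undot t) j).
Proof.
move=> bt; apply: (iffP (mem_colB _ _ (rows_in_undot bt))) => -[r];
  by move/undot_Some => tr; exists r => //; apply/undot_Some.
Qed.

(** * Invariance of minimum cuts under one move *)

Section KMoveCuts.

Variables (k B C : nat) (t : dtab).
Hypothesis tinc : sInc k.+1 t.
Hypothesis trows : rows_in B (dshape t).

Let u := kmove k.+1 t.
Let T := colB B (undot t).
Let T' := colB B (undot u).

Let memT j v : reflect (exists r, t r j = Some (DNum v)) (v \in T j).
Proof. exact: mem_undot_colB. Qed.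

Let memT' j v : reflect (exists r, u r j = Some (DNum v)) (v \in T' j).
Proof. by apply: mem_undot_colB => r c; rewrite dshape_kmove; exact: trows. Qed.

Lemma kmove_off j v : v != k.+1 -> (v \in T j) = (v \in T' j).
Proof.
move=> vk; apply/memT/memT' => -[r] h; exists r; move: h; rewrite /u kmoveE.
  by move->; rewrite /= (negbTE vk).
case E: (t r j) => [[x|]|] //=; first by case: ifP.
by case: ifP => // _ [vE]; rewrite vE eqxx in vk.
Qed.

(** A [k.+1] above the dot would already lie in column [p], so it comes from the left. *)
Lemma k_added p : k.+1 \in T' p -> k.+1 \notin T p ->
  exists r, [/\ t r p = Some Dot, t r p.-1 = Some (DNum k.+1) & 0 < p].
Proof.
move=> /memT'[r] + nT.
have nk r' : t r' p <> Some (DNum k.+1).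
  move=> tk; case/negP: nT; apply/memT.
  by exists r'.
rewrite /u kmoveE; case E: (t r p) => [[x|]|] //=.
  by case: ifP => // _ [xk]; case: (nk r); rewrite E xk.
case: ifP => // ad _; have [/nk//|tk] := adj_num tinc E ad.
exists r; split=> //.
by have /andP[] : (0 < r) && (0 < p) by apply: (cell0 tinc); rewrite E.
Qed.

(** A dot below would receive [k.+1] and keep it in column [p]. *)
Lemma k_removed p : k.+1 \in T p -> k.+1 \notin T' p ->
  exists r, [/\ t r p = Some (DNum k.+1), t r p.+1 = Some Dot & t r.+1 p <> Some Dot].
Proof.
move=> /memT[r tk] nT.
have nk r' : u r' p <> Some (DNum k.+1).
  move=> uk; case/negP: nT; apply/memT'.
  by exists r'.
have nd : t r.+1 p <> Some Dot.
  by move=> td; apply: (nk r.+1); apply: (dot_gets_num tk td); left.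
exists r; split=> //; have [||//] := adj_dot tinc tk => //.
apply/negPn/negP => ad; apply: (nk r).
by rewrite /u kmoveE tk /= eqxx (negbTE ad).
Qed.

Lemma kmove_cuts : cuts_le C T T'.
Proof.
have [_ pos rinc cinc] := tinc; have uinc := kmove_sInc tinc.
apply: (@cuts_le_exchange _ k.+1) => [j|j||].
- exact: undot_col_uniq tinc.
- exact: undot_col_uniq uinc.
- exact: kmove_off.
move=> p pC kT' kT; left; have [r /= [td tk _]] := k_added kT' kT.
split.
  by have /andP[] : (0 < r) && (0 < p) by apply: (cell0 tinc); rewrite tk.
move=> w wk.
have T'E j q : ~~ q k.+1 -> count q (T' j) = count q (T j).
  move=> qk; symmetry; apply: (@count_off _ k.+1) => //.
  - exact: undot_col_uniq tinc.
  - exact: undot_col_uniq uinc.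
  - exact: kmove_off.
rewrite !T'E /between ?ltnn ?andbF //.
apply: count_colB_le => r' v /undot_Some tv /andP[wv vk].
(* The counted entries lie above row [r], so their right neighbours exist and lie above the dot;
   these are numbers below [k.+1], as [k.+1] is absent from that column. *)
have r'r : r' < r.
  rewrite ltnNge leq_eqVlt; apply/negP => /orP[/eqP rr|lt].
    by move: tv; rewrite -rr tk => -[vE]; lia.
  by have /= := cinc _ _ _ _ _ lt tk tv; lia.
have [||z tz] := sInc_cell tinc tv td (r := r') (c := p.+1); try lia.
have /= := cinc _ _ _ _ _ r'r tz td; have := rinc _ _ _ _ _ (ltnSn p) tv tz.
case: z tz => //= z tz vz zk; exists z; first by rewrite undot_Some.
suff : z != k.+1 by lia.
apply: contraNneq kT => zE; apply/memT.
by exists r'; rewrite tz zE.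
Qed.

(** The column bound ensures that the dot to the right of a departing [k.+1] is in a column at most
    [C], so the exchange has a further threshold to use. *)
Lemma kmove_cuts_rev : (forall r c x, u r c = Some (DNum x) -> c <= C) ->
  cuts_le C T' T.
Proof.
move=> uC; have [_ pos rinc cinc] := tinc; have uinc := kmove_sInc tinc.
apply: (@cuts_le_exchange _ k.+1) => [j|j||].
- exact: undot_col_uniq uinc.
- exact: undot_col_uniq tinc.
- by move=> j v vk; rewrite kmove_off.
move=> p pC kT kT'; right; have [r [tk td nd]] := k_removed kT kT'.
split; first by apply: (uC r p.+2 k.+1); apply: (dot_gets_num tk td); right.
move=> w wk.
have T'E j q : ~~ q k.+1 -> count q (T' j) = count q (T j).
  move=> qk; symmetry; apply: (@count_off _ k.+1) => //.
  - exact: undot_col_uniq tinc.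
  - exact: undot_col_uniq uinc.
  - exact: kmove_off.
rewrite !T'E /between ?ltnn //.
apply: count_colB_le => r' v /undot_Some tv /andP[kv vw].
have rr' : r < r'.
  rewrite ltnNge leq_eqVlt; apply/negP => /orP[/eqP rr|lt].
    by move: tv; rewrite rr td.
  by have /= := cinc _ _ _ _ _ lt tv td; lia.
have [||z tz] := sInc_cell tinc tk tv (r := r') (c := p.+1); try lia.
have := cinc _ _ _ _ _ rr' tk tz; have := rinc _ _ _ _ _ (ltnSn p.+1) tz tv.
case: z tz => [z|] tz /=.
  by move=> zv kz; exists z; [rewrite undot_Some | lia].
(* A dot here would sit directly below the departing [k.+1]. *)
by move=> _ _; case: nd; rewrite -(dot_next_col tinc rr' tk tz).
Qed.

End KMoveCuts.

(** * Anti-rectification *)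

Lemma rslides_ncols m t C : sInc m t ->
  (forall r c x, rslides m t r c = Some (DNum x) -> c <= C) ->
  (forall r c x, t r c = Some (DNum x) -> c <= C).
Proof.
elim: m t => //= k IH t tinc H; apply: (kmove_ncols tinc).
exact: IH (kmove_sInc tinc) H.
Qed.

Lemma rslides_cuts m t B C : sInc m t -> rows_in B (dshape t) ->
  (forall r c x, rslides m t r c = Some (DNum x) -> c <= C) ->
  cuts_le C (colB B (undot t)) (colB B (undot (rslides m t))) /\
  cuts_le C (colB B (undot (rslides m t))) (colB B (undot t)).
Proof.
elim: m t => [|k IH] t tinc trows H.
  by split=> x M th ?; exists th.
have uinc := kmove_sInc tinc.
have urows : rows_in B (dshape (kmove k.+1 t)).
  by move=> r c; rewrite dshape_kmove; exact: trows.
have [le ge] := IH _ uinc urows H; rewrite [rslides _ _]/=; split.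
  exact: cuts_le_trans (kmove_cuts (C := C) tinc trows) le.
apply: cuts_le_trans ge (kmove_cuts_rev tinc trows _).
exact: rslides_ncols uinc H.
Qed.

Lemma colB_ext B t t' : (forall r c, t r c = t' r c) -> colB B t =1 colB B t'.
Proof. by move=> E j; apply: eq_pmap => r; exact: E. Qed.

Lemma cuts_le_ext C T1 T2 T1' T2' :
  T1 =1 T1' -> T2 =1 T2' -> cuts_le C T1 T2 -> cuts_le C T1' T2'.
Proof.
move=> E1 E2 H x M th /H[th' A le]; exists th' => //; move: le.
by rewrite /cutcost; under eq_bigr do rewrite E2; under [X in _ <= X]eq_bigr do rewrite E1.
Qed.

Lemma undot_embed t D r c : undot (embed t D) r c = t r c.
Proof. by rewrite /undot /embed; case: (t r c) => //; case: ifP. Qed.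

(** Added dots may occupy new rows, so the claim is made for all large [B]; successive steps can
    then share one bound. *)
Lemma arstep_cuts t t' C : arstep t t' ->
  (forall r c, isSome (t' r c) -> c <= C) ->
  (forall r c, isSome (t r c) -> c <= C) /\
  exists B0, forall B, B0 <= B ->
    cuts_le C (colB B t) (colB B t') /\ cuts_le C (colB B t') (colB B t).
Proof.
move=> [_ [m [D [_ _ einc t'E]]]] t'C.
have H r c x : rslides m (embed t D) r c = Some (DNum x) -> c <= C.
  by move=> E; apply: (t'C r); rewrite t'E /undot E.
split.
  move=> r c; case E: (t r c) => [x|] // _.
  by apply: (rslides_ncols einc H (x := x) (r := r)); rewrite /embed E.
have [B0 rows] : exists B, rows_in B (dshape (embed t D)).
  by case: einc => /skew_rows.
exists B0 => B le.
have rowsB : rows_in B (dshape (embed t D)).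
  by move=> r c /rows /andP[-> h]; exact: leq_trans h le.
have tE := colB_ext B (undot_embed t D).
have t'E' : colB B (undot (rslides m (embed t D))) =1 colB B t'.
  by apply: colB_ext => r c; rewrite t'E.
by have [l g] := rslides_cuts einc rowsB H; split; [apply: cuts_le_ext l | apply: cuts_le_ext g].
Qed.

Lemma antirect_cuts t u C : antirect t u ->
  (forall r c, isSome (u r c) -> c <= C) ->
  (forall r c, isSome (t r c) -> c <= C) /\
  exists B0, forall B, B0 <= B ->
    cuts_le C (colB B t) (colB B u) /\ cuts_le C (colB B u) (colB B t).
Proof.
elim=> {t u} [t _ tC|t t' u _ st _ IH uC].
  by split=> //; exists 0 => B _; split=> x M th ?; exists th.
have [t'C [B1 H1]] := IH uC; have [tC [B2 H2]] := arstep_cuts st t'C.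
split=> //; exists (maxn B1 B2) => B; rewrite geq_max => /andP[/H1[l1 g1] /H2[l2 g2]].
by split; [apply: cuts_le_trans l2 l1 | apply: cuts_le_trans g1 g2].
Qed.

Lemma tab_bound B C (t : tab) : rows_in B (tshape t) ->
  (forall r c, isSome (t r c) -> c <= C) ->
  exists M, forall r c x, t r c = Some x -> x < M.
Proof.
move=> tB tC; exists (\max_(r < B.+1) \max_(c < C.+1) odflt 0 (t r c)).+1 => r c x tx.
have ts : isSome (t r c) by rewrite tx.
have /andP[_ rB] := tB _ _ ts; have cC := tC _ _ ts.
rewrite ltnS; apply: (leq_trans _ (@leq_bigmax _ _ (Ordinal (rB : r < B.+1)))).
apply: (leq_trans _ (@leq_bigmax _ _ (Ordinal (cC : c < C.+1)))).
by rewrite /= tx.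
Qed.

Lemma all_colB B t j M :
  (forall r c x, t r c = Some x -> x < M) -> all (ltn^~ M) (colB B t j).
Proof.
move=> tM; apply/allP => v; rewrite /colB mem_pmap => /mapP[r _ tv].
exact: tM (esym tv).
Qed.

Lemma col_colB B la (P : tab) j : rows_in (size la) (tshape P) -> size la <= B ->
  col la P j = colB B P j.
Proof.
move=> rows le; rewrite /colB -(subnKC le) iotaD pmap_cat -[LHS]cats0; congr (_ ++ _).
have : forall r, r \in iota (1 + size la) (B - size la) -> P r j = None.
  move=> r; rewrite mem_iota => h; case E: (P r j) => [x|] //.
  by have := rows r j; rewrite /tshape E => /(_ isT); lia.
elim: (iota _ _) => //= r s IH H; rewrite H ?inE ?eqxx //=.
by apply: IH => r' rs; apply: H; rewrite inE rs orbT.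
Qed.

(** * Minimum cuts of an anti-normal tableau *)

Lemma antinormal_right_neighbour (t : tab) C r c : antinormal (tshape t) ->
  (exists r, isSome (t r C)) -> c < C -> isSome (t r c) -> isSome (t r c.+1).
Proof.
move=> [a [b [mu [pmu _ DE]]]] [r0 h0] cC h.
have := DE r c.+1; have := DE r c; have := DE r0 C.
rewrite /tshape h h0 /in_young !nth_nseq; do 2!case: ifP => _; lia.
Qed.

(** Entries escaping a column's charge are pushed right: one that is at least [th n.+1] has a right
    neighbour strictly above [th n.+1]. Nothing escapes the last column, since [M] exceeds all
    entries. *)
Lemma antinormal_cut_ge (t : tab) B C x M th : incr t -> antinormal (tshape t) ->
  (exists r, isSome (t r C)) -> (forall r c v, t r c = Some v -> v < M) ->
  thresholds 0 C x M th -> 0 < C ->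
  count (fun v => x < v) (colB B t 1) <= cutcost 0 C (colB B t) th.
Proof.
move=> [_ _ rinc _] an tC tM Hth C0; have [th0 thC mono] := Hth.
suff H n : n < C -> count (fun v => x < v) (colB B t 1) <=
    \sum_(0 <= j < n) count (between (th j) (th j.+1)) (colB B t j.+1)
    + count (fun v => th n < v) (colB B t n.+1).
  apply: (leq_trans (H C.-1 _)); first lia.
  rewrite /cutcost -[in leqRHS](prednK C0) big_nat_recr //= leq_add2l prednK //.
  apply/eq_leq/eq_in_count => v; rewrite /colB mem_pmap => /mapP[r _ tv].
  by rewrite /between thC (tM _ _ _ (esym tv)) andbT.
elim: n => [|n IH] nC; first by rewrite big_geq // th0.
apply: leq_trans (IH (ltnW nC)) _; rewrite big_nat_recr //= -addnA leq_add2l.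
apply: leq_trans (@count_le_add _ _ (between (th n) (th n.+1))
                    (fun v => th n.+1 <= v) _ _) _.
  by move=> v; rewrite /between; lia.
rewrite leq_add2l; apply: count_colB_le => r v tv le.
have : isSome (t r n.+2) by apply: (antinormal_right_neighbour an tC nC); rewrite tv.
case E: (t r n.+2) => [w|] // _; exists w => //.
exact: leq_ltn_trans le (rinc _ _ _ _ _ (ltnSn _) tv E).
Qed.

(** The thresholds $x,M,\dots,M$ leave empty intervals for all columns but the first. *)
Lemma first_column_cut (T : nat -> seq nat) C x M : 0 < C -> x <= M ->
  exists2 th, thresholds 0 C x M th &
  cutcost 0 C T th <= count (fun v => x < v) (T 1).
Proof.
move=> C0 xM; exists (fun j => if j == 0 then x else M).
  split=> //; first by rewrite ifN //; lia.
  by move=> j _ /=; case: eqP.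
rewrite /cutcost big_ltn // big_nat big1 ?addn0 /=.
  by apply: sub_count => v /andP[].
move=> j /andP[j0 _]; rewrite ifN; last lia.
by apply/eqP; rewrite -leqn0 leqNgt -has_count; apply/hasPn => v _; rewrite /between; lia.
Qed.

Theorem theorem5p9 (P Psw : tab) (la : seq nat) (C : nat) :
  incr P -> is_part la -> (forall r c, tshape P r c = in_young la r c) ->
  ncols P C ->
  antirect P Psw -> incr Psw -> antinormal (tshape Psw) -> ncols Psw C ->
  forall x, (exists r, Psw r 1 = Some x) <-> x \in Pij la P 1 C.
Proof.
move=> Pinc _ Psh [[rC PrC] PC] ar Sinc San [SC1 SC] y.
have [Psk Ppos _ Pcol] := Pinc; have [Ssk Spos _ Scol] := Sinc.
have C0 : 0 < C by move: (Psh rC C); rewrite /tshape PrC /in_young; lia.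
have Prows : rows_in (size la) (tshape P).
  move=> r c; rewrite Psh /in_young => /and3P[r0 c0 cla].
  rewrite r0 /= leqNgt; apply/negP => lt.
  by move: cla; rewrite nth_default; lia.
have [B2 Srows] := skew_rows Ssk.
have [_ [B1 eqv]] := antirect_cuts ar SC.
pose B := maxn B1 (maxn B2 (size la)).
have [le ge] := eqv B (leq_maxl _ _).
have SrowsB : rows_in B (tshape Psw) by move=> r c /Srows; lia.
have colE j : col la P j = colB B P j by apply: col_colB => //; lia.
have [M1 PM] := tab_bound Prows PC; have [M2 SM] := tab_bound SrowsB SC.
have Puniq j : uniq (col la P j) by rewrite colE; exact: colB_uniq.
have PijE : Pij la P 1 C =
    foldr (fun k acc => tri (col la P k) acc) (col la P C) (iota (C - C.-1) C.-1).
  by rewrite /Pij subn1; congr (foldr _ _ (iota _ _)); lia.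
have C1 : C.-1 < C by lia.
have Pijuniq : uniq (Pij la P 1 C) by rewrite PijE; exact: itri_uniq.
have Pij0 : 0 \notin Pij la P 1 C.
  have sub : exists j, {subset Pij la P 1 C <= col la P j}.
    (* The list is empty when [C] is 1, and the result is then the column itself; otherwise the
       outermost operation picks from a column. *)
    rewrite /Pij; case: (iota 1 _) => [|k s]; first by exists C.
    by exists k; exact: mem_tri.
  have [j sj] := sub; apply/negP => /sj.
  by rewrite mem_pmap => /mapP[r _ /esym/Ppos].
have S0 : 0 \notin colB B Psw 1.
  by apply/negP; rewrite mem_pmap => /mapP[r _ /esym/Spos].
suff E : Pij la P 1 C =i colB B Psw 1.
  by rewrite E; split=> /(mem_colB 1 y SrowsB).
apply: mem_of_count_gt => //; first exact: colB_uniq.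
move=> x; pose M := (maxn x (maxn M1 M2)).+1.
have PbM j : all (ltn^~ M) (col la P j).
  by rewrite colE; apply: all_colB => r c v /PM; lia.
have SbM r c v : Psw r c = Some v -> v < M by move/SM; lia.
have xM : x <= M by lia.
have costE th : cutcost 0 C (col la P) th = cutcost 0 C (colB B P) th.
  by rewrite /cutcost; apply: eq_bigr => j _; rewrite colE.
have C00 : C - C.-1.+1 = 0 by lia.
apply/eqP; rewrite eqn_leq; apply/andP; split.
  (* Upper bound: the first-column cut of [Psw] is carried back to a cut of [P], where weak duality
     applies. *)
  have [th Hth cth] := first_column_cut (colB B Psw) C0 xM.
  have [th' Hth' cth'] := ge _ _ _ Hth.
  apply: leq_trans cth; apply: leq_trans cth'; rewrite -costE PijE.
  by have := @itri_le _ _ _ Puniq PbM C.-1 x th' C1; rewrite C00; apply.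
(* Lower bound: an optimal cut of [P] is carried to [Psw], where every cut costs at least the first
   column's count. *)
have [th Hth cth] := @itri_ge _ _ _ Puniq PbM C.-1 x C1 xM.
rewrite C00 in Hth cth; rewrite PijE; apply: leq_trans cth; rewrite costE.
have [th' Hth' cth'] := le _ _ _ Hth.
by apply: leq_trans cth'; apply: (antinormal_cut_ge _ Sinc San SC1 SbM Hth' C0).
Qed.
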